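(* Let $(X,d_X)$ be a compact metric space, $k\ge2$, and let $T:\mathbb{Z}_+^k\to C^0(X,X)$ be a continuous $\mathbb{Z}_+^k$-action with generators $\{T_i:1\le i\le k\}$. Then: (1) For every integer $m>1$, $h(T^m)\le m\,h(T)$, where $T^m$ is the $\mathbb{Z}_+^k$-action with generators $\{T_i^m:1\le i\le k\}$. (2) For any $1\le l<k$ and any $\mathbb{Z}_+^l$-action $T^{(l)}$ generated by some subcollection $\{T_{i_1},\dots,T_{i_l}\}\subset\{T_1,\dots,T_k\}$, one has $h(T^{(l)})\le h(T)$. In particular, $h(T_i)\le h(T)$ for every $1\le i\le k$, where $h(T_i)$ is the topological entropy of the single map $T_i:X\to X$.
   Context: $\mathbb{Z}_+=\{0,1,2,\dots\}$. $C^0(X,X)$ is the set of continuous maps $X\to X$. For $k\ge1$, a continuous $\mathbb{Z}_+^k$-action on $X$ is a monoid homomorphism $T:\mathbb{Z}_+^k\to C^0(X,X)$; its generators are the (commuting) maps $T_i=T(0,\dots,0,1,0,\dots,0)$ with $1$ in the $i$-th place, $1\le i\le k$. Friedland's entropy: the orbit space of an action $T$ with generators $T_1,\dots,T_k$ is $$X_T=\Bigl\{\{x_n\}_{n\in\mathbb{Z}_+}\in\prod_{n\in\mathbb{Z}_+}X:\ \text{for every } n\in\mathbb{Z}_+ \text{ there is } i_n\in\{1,\dots,k\} \text{ with } T_{i_n}(x_n)=x_{n+1}\Bigr\},$$ a compact space with metric $d_{X_T}(\bar x,\bar y)=\sum_{n=0}^\infty 2^{-n}d_X(x_n,y_n)$.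 The shift $\sigma_T:X_T\to X_T$ is $\sigma_T(\{x_n\}_n)=\{x_{n+1}\}_n$. The entropy of the action is $h(T):=h(\sigma_T)\in[0,\infty]$, the usual (Bowen) topological entropy of the continuous map $\sigma_T$. For a continuous map $f$ of a compact metric space $(Z,d)$, the topological entropy is $h(f)=\lim_{\varepsilon\to0}\limsup_{n\to\infty}\frac1n\log s(f,n,\varepsilon)$, where $s(f,n,\varepsilon)$ is the largest cardinality of a set $F\subset Z$ such that $\max_{0\le i\le n-1}d(f^i x,f^i y)>\varepsilon$ for all distinct $x,y\in F$. *)

(* Defs.v *)
From HB Require Import structures.
From mathcomp Require Import all_boot all_order all_algebra.
From mathcomp Require Import all_classical all_reals all_analysis.
Set Implicit Arguments.
Unset Strict Implicit.
Unset Printing Implicit Defensive.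
Import Order.TTheory GRing.Theory Num.Theory.
Import numFieldNormedType.Exports.
Local Open Scope classical_set_scope.
Local Open Scope ring_scope.

Section entropy.
Context {R : realType} {Z : metricType R}.
Variable f : Z -> Z.

(* The seed 0 is harmless, distances being nonnegative. *)
Definition bowen_dist (n : nat) (x y : Z) : R :=
  \big[Num.max/0]_(i < n) mdist (iter i f x) (iter i f y).

Definition separated (n : nat) (e : R) (F : set Z) : Prop :=
  forall x y, F x -> F y -> x <> y -> e < bowen_dist n x y.

(* The supremum ranges over finite separated sets; arbitrarily large finite
   ones would give +oo, as an infinite one would. *)
Definition max_separated (n : nat) (e : R) : \bar R :=
  ereal_sup [set N%:R%:E | N in
    [set N | exists F : set Z, (F #= `I_N)%card /\ separated n e F]].

Definition entropy_scale (e : R) : \bar R :=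
  limn_esup (fun n => (n%:R^-1%:E * lne (max_separated n e))%E).

Definition topological_entropy : \bar R :=
  lim (entropy_scale e @[e --> 0^'+]).

End entropy.

Record action (k : nat) (X : topologicalType) := Action {
  act :> {ffun 'I_k -> nat} -> X -> X ;
  act_continuous : forall n, continuous (act n) ;
  act0 : act 0 = id ;
  actD : forall m n, act (m + n) = act m \o act n }.

Definition basis_vec (k : nat) (i : 'I_k) : {ffun 'I_k -> nat} :=
  [ffun j => (j == i) : nat].

Definition generator (k : nat) (X : topologicalType) (T : action k X)
  (i : 'I_k) : X -> X := T (basis_vec i).

Definition generated_by (k : nat) (X : topologicalType) (T : action k X)
  (f : 'I_k -> X -> X) : Prop := forall i, generator T i = f i.

(* [generated_by] determines the action: any commuting family of continuous
   maps generates exactly one action. *)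
Section generated.
Context {k : nat} {X : topologicalType}.
Implicit Types (f : 'I_k -> X -> X) (n : {ffun 'I_k -> nat}).

Let compn f n (s : seq 'I_k) : X -> X :=
  foldr (fun i g => iter (n i) (f i) \o g) id s.

Let iterC (g h : X -> X) m : g \o h = h \o g -> iter m g \o h = h \o iter m g.
Proof.
move=> gh; elim: m => [//|m IH]; apply/funext => x /=.
by move: (congr1 (@^~ x) IH) (congr1 (@^~ (iter m g x)) gh) => /= -> ->.
Qed.

Let iter_comm (g h : X -> X) m p :
  g \o h = h \o g -> iter m g \o iter p h = iter p h \o iter m g.
Proof. by move=> gh; apply/iterC/esym/iterC. Qed.

Let compnD f n n' s : (forall i j, f i \o f j = f j \o f i) ->
  compn f (n + n') s = compn f n s \o compn f n' s.
Proof.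
move=> fC; elim: s => [//|i s IH] /=; rewrite IH.
have comm : iter (n' i) (f i) \o compn f n s = compn f n s \o iter (n' i) (f i).
  elim: s {IH} => [//|j s IH] /=.
  apply/funext => x /=; move: (congr1 (@^~ x) IH) => /= <-.
  exact: (congr1 (@^~ _) (iter_comm (n' i) (n j) (fC i j))).
apply/funext => x /=; rewrite ffunE iterD.
by have /= -> := congr1 (@^~ (compn f n' s x)) comm.
Qed.

Let compn_cont f n s : (forall i, continuous (f i)) -> continuous (compn f n s).
Proof.
move=> fc; elim: s => [|i s IH] x; first exact: cvg_id.
apply: continuous_comp; first exact: IH.
move: (compn f n s x) => y; elim: (n i) y => [|m IHm] y; first exact: cvg_id.
exact: (continuous_comp (IHm y) (fc i _)).
Qed.

Let compn0 f s : compn f 0 s = id.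
Proof. by elim: s => [//|i s IH] /=; rewrite IH ffunE. Qed.

Let compn_basis f i s : uniq s ->
  compn f (basis_vec i) s = if i \in s then f i else id.
Proof.
elim: s => [//|j s IH] /= /andP[js us]; rewrite IH// inE ffunE eq_sym.
by case: eqVneq js => [<- /negbTE ->|_ _].
Qed.

Let compnE (T : action k X) n s :
  compn (generator T) n s = T (\sum_(i <- s) basis_vec i *+ n i).
Proof.
elim: s => [|i s IH]; first by rewrite big_nil act0.
rewrite big_cons actD -IH /=; congr (_ \o _).
elim: (n i) => [|m IHm]; first by rewrite mulr0n act0.
by rewrite mulrS actD -IHm; apply/funext.
Qed.

Let actE (T : action k X) n : T n = compn (generator T) n (enum 'I_k).
Proof.
rewrite compnE; congr (T _); apply/ffunP => j.
rewrite big_enum sum_ffunE (bigD1 j)//= big1 ?addr0.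
  by rewrite ffunMnE ffunE eqxx /= -mulr_natr mul1r natn.
by move=> i ij; rewrite ffunMnE ffunE eq_sym (negbTE ij) /= mul0rn.
Qed.

Lemma generated_by_exists_unique f :
  (forall i, continuous (f i)) -> (forall i j, f i \o f j = f j \o f i) ->
  exists! T : action k X, generated_by T f.
Proof.
move=> fc fC.
exists (Action (fun n => @compn_cont f n (enum 'I_k) fc) (@compn0 f (enum 'I_k))
  (fun m n => @compnD f m n (enum 'I_k) fC)); split=> [i|S Sf].
  by rewrite /generator /= compn_basis ?enum_uniq// mem_enum.
have {}Sf : generator S = f by apply/funext.
have: act S = (compn f)^~ (enum 'I_k) by apply/funext => n; rewrite actE Sf.
case: S {Sf} => S Sc S0 SD /= SE; subst S.
by congr Action; exact: Prop_irrelevance.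
Qed.

End generated.

(* Compactness of [X] makes the series [orbit_dist] converge, so it is a
   parameter of the type on which the metric structure is installed. *)
Record orbit_space (R : realType) (X : metricType R) (cX : compact [set: X])
    (k : nat) (T : action k X) := OrbitSpace {
  orbit_seq :> nat -> X ;
  orbit_seqP : forall n, exists i, generator T i (orbit_seq n) = orbit_seq n.+1 }.

Section orbit_metric.
Context {R : realType} {X : metricType R} (cX : compact [set: X]).
Context {k : nat} (T : action k X).
Local Notation XT := (orbit_space cX T).

HB.instance Definition _ := gen_eqMixin XT.
HB.instance Definition _ := gen_choiceMixin XT.

Definition orbit_dist (x y : XT) : R :=
  limn (series (fun n => 2 ^- n * mdist (x n) (y n))).

Let term (x y : XT) n : R := 2 ^- n * mdist (x n) (y n).

Let term_ge0 x y n : 0 <= term x y n.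
Proof. by rewrite mulr_ge0 ?mdist_ge0// invr_ge0 exprn_ge0. Qed.

Let mdist_bounded (a : X) : exists M : R, forall x, mdist a x <= M.
Proof.
have /compact_near_coveringP := cX.
move=> /(_ R +oo (fun M x => mdist a x <= M) _) H.
have [x _|M [_ HM]] := H.
  exists (ball x 1, [set M | mdist a x + 1 < M]) => /=.
    split; [exact: nbhsx_ballx|exact/nbhs_pinfty_gt/num_real].
  move=> [y M]/= [+ /ltW]; rewrite ballEmdist => /= /ltW xy; apply: le_trans.
  by rewrite (le_trans (metric_triangle _ x _))// lerD2l.
by exists (M + 1) => x; apply: (HM (M + 1)); rewrite ?ltrDl.
Qed.

Let cvg_term x y : cvgn (series (term x y)).
Proof.
have [M HM] := mdist_bounded (x 0%N).
have M0 : 0 <= M by apply: le_trans (HM (x 0%N)); exact: mdist_ge0.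
apply: (@series_le_cvg _ _ (geometric (M + M) 2^-1)) => [|n|n|].
- exact: term_ge0.
- by rewrite /= mulr_ge0 ?addr_ge0// exprn_ge0// invr_ge0.
- rewrite /term /= mulrC exprVn ler_wpM2r ?invr_ge0 ?exprn_ge0//.
  rewrite (le_trans (metric_triangle _ (x 0%N) _))// lerD//.
  by rewrite metric_sym.
- by apply: is_cvg_geometric_series; rewrite ger0_norm ?invr_ge0// invf_lt1 ?ltr1n.
Qed.

Let orbit_distxx x : orbit_dist x x = 0.
Proof.
rewrite /orbit_dist (_ : series _ = fun=> 0) ?lim_cst//.
apply/funext => n; rewrite /series/= big1// => i _.
by rewrite mdistxx mulr0.
Qed.

Let orbit_dist_positivity x y : orbit_dist x y = 0 -> x = y.
Proof.
move=> xy0; suff: orbit_seq x = orbit_seq y.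
  case: x y {xy0} => [x xP] [y yP] /= xy; subst y.
  by congr OrbitSpace; exact: Prop_irrelevance.
apply/funext => n; apply: mdist_positivity; apply/eqP.
have : series (term x y) n.+1 <= 0.
  rewrite -xy0; apply: (@nondecreasing_cvgn_le _ (series (term x y))) => //.
  by apply: nondecreasing_series => i _ _; exact: term_ge0.
rewrite /series/= big_nat_recr//= => le0.
have : term x y n <= 0.
  by apply: le_trans le0; rewrite lerDr sumr_ge0.
rewrite /term pmulr_rle0 ?invr_gt0 ?exprn_gt0// => ?.
by rewrite eq_le mdist_ge0 andbT.
Qed.

Let orbit_dist_sym x y : orbit_dist x y = orbit_dist y x.
Proof.
rewrite /orbit_dist; congr (limn (series _)); apply/funext => n.
by rewrite metric_sym.
Qed.

Let orbit_dist_triangle y x z :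
  orbit_dist x z <= orbit_dist x y + orbit_dist y z.
Proof.
rewrite /orbit_dist -(lim_seriesD (@cvg_term x y) (@cvg_term y z)).
apply: (lim_series_le (@cvg_term x z)); first exact: is_cvg_seriesD.
by move=> n; rewrite fctE -mulrDr ler_wpM2l ?metric_triangle.
Qed.

HB.instance Definition _ := isMetric.Build R XT
  orbit_distxx orbit_dist_positivity orbit_dist_sym orbit_dist_triangle.

Lemma mdist_orbitE (x y : XT) : mdist x y = orbit_dist x y.
Proof. by []. Qed.

Definition shift (x : XT) : XT :=
  OrbitSpace cX (fun n => orbit_seqP x n.+1).

Definition friedland_entropy : \bar R := topological_entropy shift.

End orbit_metric.

(* Main.v *)
(** Entropy comparison: if [phi] maps the phase space of [f] to that of [g] and
    [e]-separation of two points at time [n] under [f] forces [d]-separation of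
    their images at time [m * n] under [g], with [d] depending only on [e],
    then [h(f) <= m * h(g)].  For (2) and (3) the map [phi] sends an orbit of
    the smaller system to itself, seen as a point of the orbit space of [T],
    with [m = 1] and [d = e].  For (1), [phi] interpolates an orbit [y] of
    [T^m]: between [y_n] and [y_(n+1) = T_i^m y_n] it inserts the points
    [T_i^r y_n], [r < m]. *)
Require Import Defs.
From mathcomp Require Import all_boot all_order all_algebra.
From mathcomp Require Import ring.
From mathcomp Require Import all_classical all_reals all_analysis.
Import Order.TTheory GRing.Theory Num.Theory.
Import numFieldNormedType.Exports.
Local Open Scope classical_set_scope.
Local Open Scope ring_scope.
Local Open Scope ereal_scope.

(** The condition [0 <= e] prevents the seed 0 of the maximum from exceeding [e], so some time [i]
    must realise the gap. *)
Lemma lt_bowen_distP {R : realType} {Z : metricType R} (f : Z -> Z) (n : nat)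
    (e : R) (x y : Z) : (0 <= e)%R ->
  (e < bowen_dist f n x y)%R <->
  exists2 i, (i < n)%N & (e < mdist (iter i f x) (iter i f y))%R.
Proof.
move=> e0; split.
  rewrite /bowen_dist => /bigmax_gtP[|[i _ ei]].
    by rewrite ltNge e0.
  by exists (i : nat).
move=> [i ni ei]; apply/bigmax_gtP; right.
by exists (Ordinal ni).
Qed.

Lemma max_separated_ge0 {R : realType} {Z : metricType R} (f : Z -> Z) n e :
  0 <= max_separated f n e.
Proof.
apply: ereal_sup_ubound; exists 0%N => //.
exists set0; split; last by move=> x y [].
by rewrite II0 card_eq0.
Qed.

(** [phi] is injective on a separated set: equal images are at distance 0, hence not [d]-separated.
    The image is thus a separated set of the same cardinality. *)
Lemma max_separated_le {R : realType} {Y Z : metricType R} {f : Y -> Y}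
    {g : Z -> Z} {phi : Y -> Z} {n p : nat} {e d : R} : (0 <= d)%R ->
  (forall x y, (e < bowen_dist f n x y -> d < bowen_dist g p (phi x) (phi y))%R) ->
  max_separated f n e <= max_separated g p d.
Proof.
move=> d0 fg; apply: ge_ereal_sup => _ [N [F [FN Fsep]] <-].
apply: ereal_sup_ubound; exists N => //; exists (phi @` F); split.
  apply: card_eq_trans FN; apply: inj_card_eq => x y /set_mem Fx /set_mem Fy phixy.
  apply: contrapT => xy; have := fg _ _ (Fsep _ _ Fx Fy xy).
  by rewrite phixy => /lt_bowen_distP -/(_ d0)[i _]; rewrite mdistxx ltNge d0.
move=> _ _ [x Fx <-] [y Fy <-] xy; apply/fg/Fsep => // xyE.
by apply: xy; rewrite xyE.
Qed.

(** Since [1/n = m * 1/(m * n)], the sequence of [f] at [n] is bounded by [m] times that of [g] at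
    [m * n], and passing to the multiples of [m] cannot raise a limsup. *)
Lemma entropy_scale_le {R : realType} {Y Z : metricType R} {f : Y -> Y}
    {g : Z -> Z} {phi : Y -> Z} {m : nat} {e d : R} : (0 < m)%N -> (0 <= d)%R ->
  (forall n x y,
    (e < bowen_dist f n x y -> d < bowen_dist g (m * n) (phi x) (phi y))%R) ->
  entropy_scale f e <= m%:R%:E * entropy_scale g d.
Proof.
move=> m0 d0 fg; have mR0 : (0 < m%:R :> R)%R by rewrite ltr0n.
(* [limn_esup] is an infimum over neighbourhoods [A] of infinity of suprema on [A]. Moving [m] to
   the left isolates that infimum. *)
rewrite -lee_pdivrMl//; apply: le_ereal_inf_tmp => _ [A [N _ NA] <-].
rewrite lee_pdivrMl//.
pose B := [set n | (N.+1 <= n)%N].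
apply: (@le_trans _ _ (ereal_sup
    ((fun n => n%:R^-1%:E * lne (max_separated f n e)) @` B))).
  by apply: ereal_inf_lbound; exists B => //; exists N.+1.
apply: ge_ereal_sup => _ [n Nn <-].
have n0 : (0 < n)%N by exact: leq_ltn_trans Nn.
apply: (@le_trans _ _ (m%:R%:E *
    ((m * n)%:R^-1%:E * lne (max_separated g (m * n) d)))).
  rewrite muleA -EFinM natrM invfM mulrA divff ?gt_eqF// mul1r.
  rewrite lee_wpmul2l ?lee_fin ?invr_ge0//.
  by rewrite lee_lne ?in_itv /= ?leey ?andbT ?max_separated_ge0// (max_separated_le d0 (fg n)).
rewrite lee_wpmul2l ?lee_fin//; apply: ereal_sup_ubound.
exists (m * n)%N => //; apply: NA => /=.
by rewrite (leq_trans (ltnW Nn))// leq_pmull.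
Qed.

(** A smaller scale separates more points, so [entropy_scale] is monotone: this is the comparison
    with [phi = id] and [m = 1]. Hence the [lim] defining the entropy is a true limit, and a
    supremum. *)
Lemma cvg_entropy_scale {R : realType} {Z : metricType R} (f : Z -> Z) :
  entropy_scale f e @[e --> 0^'+] -->
  ereal_sup (entropy_scale f @` [set` Interval (BRight 0%R) +oo%O]).
Proof.
apply: nonincreasing_at_right_cvge => // d e; rewrite !in_itv/= !andbT.
move=> /ltW d0 _ de.
rewrite -[leRHS]mul1e.
apply: (@entropy_scale_le _ _ _ _ _ id 1) => // n x y.
by rewrite mul1n; exact: le_lt_trans.
Qed.

Lemma topological_entropy_le {R : realType} {Y Z : metricType R} (f : Y -> Y)
    (g : Z -> Z) (phi : Y -> Z) (m : nat) : (0 < m)%N ->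
  (forall e, (0 < e)%R -> exists2 d, (0 < d)%R &
    forall n x y,
    (e < bowen_dist f n x y -> d < bowen_dist g (m * n) (phi x) (phi y))%R) ->
  topological_entropy f <= m%:R%:E * topological_entropy g.
Proof.
move=> m0 fg; apply: (cvge_to_le (cvgP _ (cvg_entropy_scale f))).
near=> e; have [//|d d0 /(entropy_scale_le m0 (ltW d0)) /le_trans] := fg e.
apply; rewrite lee_wpmul2l ?lee_fin//.
(* The entropy of [g] being a supremum over scales, [d] does not have to tend to 0 with [e]. *)
rewrite /topological_entropy (cvg_lim _ (cvg_entropy_scale g))//.
by apply: ereal_sup_ubound; exists d => //=; rewrite in_itv/= d0.
Unshelve. all: by end_near. Qed.

Local Open Scope ring_scope.

Lemma compact_mdist_bounded {R : realType} {X : metricType R} :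
  compact [set: X] -> exists2 D : R, 0 <= D & forall x y : X, mdist x y <= D.
Proof.
move=> /compact_near_coveringP cX.
have [[a _]|X0] := pselect ([set: X] !=set0); last first.
  by exists 0 => // x; exfalso; apply: X0; exists x.
(* By compactness, a bound on the distance to [a] valid near each point for large [M] holds on all
   of [X] for large [M]. *)
have : \forall M \near +oo, [set: X] `<=` (fun x => mdist x a <= M).
  apply: cX => x _; exists (ball x 1, [set M | 1 + mdist x a <= M]) => /=.
    by split; [exact: nbhsx_ballx|exact/nbhs_pinfty_ge/num_real].
  move=> [y M]/= []; rewrite ballEmdist/= => xy; apply: le_trans.
  by rewrite (le_trans (metric_triangle _ x _))// lerD2r metric_sym ltW.
move=> [M0 [_ HM]].
have M0a x : mdist x a <= M0 + 1 by apply: HM; rewrite ?ltrDl.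
exists (M0 + 1 + (M0 + 1)).
  by rewrite addr_ge0// (le_trans (mdist_ge0 a a)).
move=> x y; rewrite (le_trans (metric_triangle _ a _))// lerD//.
by rewrite metric_sym.
Qed.

Section orbit_space.
Context {R : realType} {X : metricType R} (cX : compact [set: X]).
Context {k : nat} (T : action k X).
Implicit Types x y : orbit_space cX T.

(* As [1/2 < 3/4 < 1], the estimate on the first [J] coordinates and the
   estimate on the tail are both dominated by one geometric series of sum [e]. *)
Lemma orbit_term_le (e : R) : 0 < e -> exists J : nat, forall x y,
  (forall j, (j < J)%N -> mdist (x j) (y j) <= e / 4) ->
  forall n, 2 ^- n * mdist (x n) (y n) <= geometric (e / 4) (3 / 4) n.
Proof.
move=> e0; have [D D0 HD] := compact_mdist_bounded cX.
have e4 : 0 < e / 4 by rewrite divr_gt0.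
have [J _ HJ] : \forall n \near \oo, geometric D (2 / 3) n <= e / 4.
  have q1 : `|2 / 3 : R| < 1.
    by rewrite ger0_norm ?divr_ge0// ltr_pdivrMr// mul1r ltr_nat.
  near=> n; rewrite (le_trans (ler_norm _))//.
  rewrite ltW//; near: n.
  by have /cvgr0_norm_lt := cvg_geometric D q1; exact.
exists J => x y xy n.
have h n' : (3 / 4) ^+ n' = 2 ^- n' * (3 / 2) ^+ n' :> R.
  by rewrite -exprVn -exprMn; congr (_ ^+ _); field.
(* Cancelling [2 ^- n] leaves [mdist (x n) (y n) <= e / 4 * (3 / 2) ^+ n]. Beyond [J] the right side
   exceeds the diameter bound [D]. *)
rewrite /geometric/= h mulrCA ler_pM2l ?invr_gt0 ?exprn_gt0//.
have [/xy/le_trans->//|Jn] := ltnP n J.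
  by rewrite ler_peMr ?(ltW e4)// exprn_ege1// ler_pdivlMr// mul1r ler_nat.
rewrite (le_trans (HD _ _))// -[3 / 2]invf_div exprVn ler_pdivlMr ?exprn_gt0//.
exact: HJ.
Unshelve. all: by end_near. Qed.

Lemma cvg_orbit_dist x y : cvgn (series (fun n => 2 ^- n * mdist (x n) (y n))).
Proof.
have [D D0 HD] := compact_mdist_bounded cX.
apply: (@series_le_cvg _ _ (geometric D 2^-1)) => [n|n|n|].
- by rewrite mulr_ge0 ?mdist_ge0// invr_ge0 exprn_ge0.
- by rewrite /= mulr_ge0// exprn_ge0// invr_ge0.
- by rewrite /= mulrC exprVn ler_wpM2r// invr_ge0 exprn_ge0.
- by apply: is_cvg_geometric_series; rewrite ger0_norm ?invr_ge0// invf_lt1 ?ltr1n.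
Qed.

(** All terms being nonnegative, one of them is at most the whole sum. This carries separation from
    a coordinate to the orbit space. *)
Lemma mdist_orbit_ge x y n : 2 ^- n * mdist (x n) (y n) <= mdist x y.
Proof.
have t0 i : 0 <= 2 ^- i * mdist (x i) (y i).
  by rewrite mulr_ge0 ?mdist_ge0// invr_ge0 exprn_ge0.
apply: (@le_trans _ _ (series (fun n => 2 ^- n * mdist (x n) (y n)) n.+1)).
  by rewrite /series/= big_nat_recr//= lerDr sumr_ge0.
rewrite mdist_orbitE; apply: nondecreasing_cvgn_le; last exact: cvg_orbit_dist.
by apply: nondecreasing_series => i _ _; exact: t0.
Qed.

(** Contrapositive of the geometric domination, whose sum is [(e / 4) / (1 - 3 / 4) = e]. It matters
    that [J] is the same for all pairs of orbits. *)
Lemma mdist_orbit_gt (e : R) : 0 < e -> exists J : nat, forall x y,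
  e < mdist x y -> exists2 j, (j < J)%N & e / 4 < mdist (x j) (y j).
Proof.
move=> e0; have [J HJ] := orbit_term_le _ e0; exists J => x y exy.
apply: contrapT => small; move: exy; apply/negP; rewrite -leNgt mdist_orbitE.
have q1 : `|3 / 4 : R| < 1.
  by rewrite ger0_norm ?divr_ge0// ltr_pdivrMr// mul1r ltr_nat.
have -> : e = limn (series (geometric (e / 4) (3 / 4))).
  by rewrite (cvg_lim _ (cvg_geometric_series q1))//; field.
apply: lim_series_le; first exact: cvg_orbit_dist.
  exact: is_cvg_geometric_series.
apply: HJ => j jJ; rewrite leNgt; apply/negP => ej.
by apply: small; exists j.
Qed.

Lemma iter_shiftE n x j : iter n (@Defs.shift _ _ cX _ T) x j = x (n + j)%N.
Proof. by elim: n j => [//|n IH] j; rewrite iterS/= IH addnS. Qed.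

End orbit_space.

Lemma friedland_entropy_sub {R : realType} {X : metricType R}
    (cX : compact [set: X]) {k l : nat} (T : action k X) (Tl : action l X)
    (s : 'I_l -> 'I_k) : generated_by Tl (fun j => generator T (s j)) ->
  (friedland_entropy cX Tl <= friedland_entropy cX T)%E.
Proof.
move=> Tls.
have orbP (x : orbit_space cX Tl) n : exists i, generator T i (x n) = x n.+1.
  by have [i xi] := orbit_seqP x n; exists (s i); rewrite -Tls.
pose phi x := OrbitSpace cX (orbP x).
rewrite -[leRHS]mul1e; apply: (topological_entropy_le _ _ phi 1) => // e e0.
exists e => // n x y.
rewrite mul1n !lt_bowen_distP ?(ltW e0)// => -[i ni ei]; exists i => //.
(* [phi] keeps the underlying sequence, hence all distances; it remains to see that it commutes with
   the shifts. *)
have iterE z : iter i (@Defs.shift _ _ cX _ T) (phi z)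
    = phi (iter i (@Defs.shift _ _ cX _ Tl) z).
  by elim: i {ni ei} => [//|i IH]; rewrite !iterS IH; congr OrbitSpace.
by rewrite !iterE.
Qed.

Lemma topological_entropy_generator {R : realType} {X : metricType R}
    (cX : compact [set: X]) {k : nat} (T : action k X) (i : 'I_k) :
  (topological_entropy (generator T i) <= friedland_entropy cX T)%E.
Proof.
have orbP x n : exists j, generator T j (iter n (generator T i) x)
    = iter n.+1 (generator T i) x by exists i.
pose phi x := OrbitSpace cX (orbP x).
rewrite -[leRHS]mul1e; apply: (topological_entropy_le _ _ phi 1) => // e e0.
exists e => // n x y.
rewrite mul1n !lt_bowen_distP ?(ltW e0)// => -[j nj ej]; exists j => //.
(* Coordinate 0 has weight 1, so no separation is lost. *)
apply: (lt_le_trans ej); apply: le_trans (mdist_orbit_ge cX T _ _ 0).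
by rewrite expr0 invr1 mul1r !iter_shiftE addn0.
Qed.

Lemma friedland_entropy_iter {R : realType} {X : metricType R}
    (cX : compact [set: X]) {k : nat} (T Tm : action k X) (m : nat) :
  (0 < m)%N -> generated_by Tm (fun i => iter m (generator T i)) ->
  (friedland_entropy cX Tm <= m%:R%:E * friedland_entropy cX T)%E.
Proof.
move=> m0 TmE.
(* Several generators may realise a step of [y]; one is fixed for each [n]. *)
pose idx (y : orbit_space cX Tm) n := projT1 (cid (orbit_seqP y n)).
have idxP y n : iter m (generator T (idx y n)) (y n) = y n.+1.
  by rewrite -TmE /idx; case: cid.
pose u y t := iter (t %% m)%N (generator T (idx y (t %/ m)%N)) (y (t %/ m)%N).
have uP y t : exists i, generator T i (u y t) = u y t.+1.
  exists (idx y (t %/ m)%N); rewrite /u -iterS.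
  (* Either [t.+1] stays in the block of [t], or the block is complete and its [m] steps lead to the
     next point of [y]. *)
  have [tm|mt] := ltnP (t %% m)%N.+1 m.
    have -> : (t.+1 = t %/ m * m + (t %% m).+1)%N by rewrite addnS -divn_eq.
    by rewrite divnMDl// modnMDl (divn_small tm) (modn_small tm) addn0.
  have tmm : (t %% m)%N.+1 = m by apply/eqP; rewrite eqn_leq mt ltn_pmod.
  have -> : (t.+1 = (t %/ m).+1 * m)%N.
    by rewrite {1}(divn_eq t m) -addnS tmm mulSn addnC.
  by rewrite mulnK// modnMl tmm idxP.
have uM y n : u y (m * n)%N = y n by rewrite /u mulKn// modnMr.
pose phi y := OrbitSpace cX (uP y).
apply: (topological_entropy_le _ _ phi) => // e e0.
have [J HJ] := mdist_orbit_gt cX Tm _ e0.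
have e4 : 0 < e / 4 by rewrite divr_gt0.
have d0 : 0 < 2 ^- (m * J) * (e / 4) by rewrite mulr_gt0// invr_gt0 exprn_gt0.
(* A gap above [e] at time [i] gives a gap above [e / 4] at a coordinate [j < J]. After [m * i]
   shifts of the interpolated orbits it sits at coordinate [m * j], of weight at least
   [2 ^- (m * J)]. *)
exists (2 ^- (m * J) * (e / 4)) => // n x y.
rewrite !lt_bowen_distP ?(ltW e0) ?(ltW d0)// => -[i ni /HJ[j jJ]].
rewrite !iter_shiftE => eij.
exists (m * i)%N; first by rewrite ltn_pmul2l.
apply: lt_le_trans (mdist_orbit_ge cX T _ _ (m * j)%N).
rewrite !iter_shiftE -mulnDr /= !uM.
apply: (@le_lt_trans _ _ (2 ^- (m * j) * (e / 4))).
  rewrite ler_pM2r// lef_pV2 ?posrE ?exprn_gt0//.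
  by rewrite ler_weXn2l ?ler1n// leq_pmul2l// ltnW.
by rewrite ltr_pM2l// invr_gt0 exprn_gt0.
Qed.

Local Open Scope ereal_scope.

Theorem proposition2p2 (R : realType) (X : metricType R)
    (cX : compact [set: X]) (k : nat) (k_ge2 : (2 <= k)%N) (T : action k X) :
  [/\ (forall m : nat, (1 < m)%N ->
        forall Tm : action k X,
          generated_by Tm (fun i => iter m (generator T i)) ->
          friedland_entropy cX Tm <= m%:R%:E * friedland_entropy cX T),
      (forall l : nat, (1 <= l < k)%N ->
        forall (s : 'I_l -> 'I_k), injective s ->
        forall Tl : action l X,
          generated_by Tl (fun j => generator T (s j)) ->
          friedland_entropy cX Tl <= friedland_entropy cX T)
    & (forall i : 'I_k,
        topological_entropy (generator T i) <= friedland_entropy cX T)].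
Proof.
split.
- by move=> m m1 Tm; apply: friedland_entropy_iter; exact: ltnW.
- by move=> l _ s _ Tl; exact: friedland_entropy_sub.
- exact: topological_entropy_generator.
Qed.
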